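(* Let $n,m \in \mathbb{N}$ with $n \geq 2$, and let $G = \sum_{i=1}^n K_{1,m}$ be the disjoint union of $n$ copies of the star $K_{1,m}$. If $n$ is odd, then $G$ is equitably 2-choosable if and only if $m \leq 2$. If $n$ is even, then $G$ is equitably 2-choosable if and only if $m \leq 7$.
   Context: All graphs are finite and simple; $\mathbb{N}=\{1,2,3,\dots\}$. A list assignment $L$ for a graph $G$ assigns to each vertex $v$ a set $L(v)$ of colors; it is a $k$-assignment if $|L(v)|=k$ for all $v$. The palette of $L$ is $\bigcup_{v} L(v)$. A proper $L$-coloring is a proper coloring $f$ with $f(v)\in L(v)$ for all $v$. If $L$ is a $k$-assignment, an equitable $L$-coloring of $G$ is a proper $L$-coloring in which each color of the palette appears on at most $\lceil |V(G)|/k \rceil$ vertices. $G$ is equitably $k$-choosable if an equitable $L$-coloring exists for every $k$-assignment $L$ for $G$. *)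

(* Defs.v *)
From mathcomp Require Import all_boot.
From mathcomp Require Export finmap.

Set Implicit Arguments.
Unset Strict Implicit.
Unset Printing Implicit Defensive.

Local Open Scope fset_scope.

Record sgraph := SGraph {
  vertex :> finType;
  adj : rel vertex;
  adj_sym : symmetric adj;
  adj_irrefl : irreflexive adj }.

Section CompleteBipartite.
Variables p q : nat.

Definition Kpq_adj : rel ('I_p + 'I_q)%type := [rel u v | is_inl u != is_inl v].

Lemma Kpq_sym : symmetric Kpq_adj.
Proof. by move=> [?|?] [?|?]. Qed.

Lemma Kpq_irrefl : irreflexive Kpq_adj.
Proof. by case. Qed.

Definition complete_bipartite := SGraph Kpq_sym Kpq_irrefl.
End CompleteBipartite.

(* Vertex (i, x) is the vertex x of the i-th copy of G. *)
Section Copies.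
Variables (n : nat) (G : sgraph).

Definition copies_adj : rel ('I_n * G)%type :=
  [rel u v | (u.1 == v.1) && adj u.2 v.2].

Lemma copies_sym : symmetric copies_adj.
Proof. by move=> u v; rewrite /copies_adj /= eq_sym adj_sym. Qed.

Lemma copies_irrefl : irreflexive copies_adj.
Proof. by move=> u; rewrite /copies_adj /= adj_irrefl andbF. Qed.

Definition disjoint_copies := SGraph copies_sym copies_irrefl.
End Copies.

(* The ceiling of a / b, for b > 0. *)
Definition ceil_divn (a b : nat) : nat := (a + b.-1) %/ b.

Section ListColoring.
Variables (G : sgraph) (C : choiceType).
Implicit Types (L : G -> {fset C}) (f : G -> C) (k : nat).

Definition k_assignment k L : Prop := forall v, #|` L v| = k.

Definition palette L : {fset C} := \bigcup_(v in G) L v.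

Definition proper_coloring f : Prop := forall u v, adj u v -> f u <> f v.

Definition proper_list_coloring L f : Prop :=
  proper_coloring f /\ forall v, f v \in L v.

Definition equitable_list_coloring k L f : Prop :=
  proper_list_coloring L f /\
  forall c, c \in palette L -> #|[set v | f v == c]%SET| <= ceil_divn #|G| k.
End ListColoring.

(* The colors range over an arbitrary type, which may be infinite. *)
Definition equitably_choosable (k : nat) (G : sgraph) : Prop :=
  forall (C : choiceType) (L : G -> {fset C}),
    k_assignment k L -> exists f : G -> C, equitable_list_coloring k L f.

(* Main.v *)
Require Import Defs.
From mathcomp Require Import all_boot.
From mathcomp Require Import finmap zify.

Set Implicit Arguments.
Unset Strict Implicit.
Unset Printing Implicit Defensive.

Local Open Scope fset_scope.

(** When [n] is even, pair up the stars: it suffices to color any two stars so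
    that each color is used at most [m + 1] times.  Fix colors [p], [q] of the two
    centers.  At most one color can be used more than [m + 1] times, and shifting
    its unforced vertices away repairs this unless some color [c] is forced on at
    least [m + 2] vertices, i.e. the leaf lists [{p, c}] of the first star and
    [{q, c}] of the second are together at least that many.  If [m <= 7], this
    cannot happen for all four choices of [(p, q)]: each choice needs at least two
    leaves from each star, and double counting the leaves leaves no room.  When
    [n] is odd and [m <= 2], the star left over after pairing is harmless.

    Conversely, with all lists [{0, 1}], an odd number of stars cannot be balanced
    when [m >= 3].  For [n] even, [n - 1] stars with lists [{0, 1}] are so
    unbalanced that the last star may use one of the colors [0], [1] at most once;
    if [m >= 8], lists [{0, 2}], [{0, 3}], [{1, 2}], [{1, 3}] on two leaves each
    and [{2, 3}] at the center force both colors twice. *)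

(** * Choosing colors under a cap *)

Lemma exists_intermediate_set (V : finType) (F D : {set V}) (k : nat) :
  F \subset D -> #|F| <= k <= #|D| ->
  exists E : {set V}, [/\ F \subset E, E \subset D & #|E| = k].
Proof.
move=> sFD /andP[]; elim: k => [|k IHk] leFk lekD.
  exists F; split=> //; lia.
have [eqFk|neqFk] := eqVneq #|F| k.+1; first by exists F.
have [||E [sFE sED cE]] := IHk; [lia | lia |].
have /properP[_ [x xD xE]]: E \proper D by rewrite properEcard sED cE.
exists (x |: E)%SET; split; first exact: subset_trans sFE (subsetUr _ _).
  by rewrite subUset sub1set xD.
by rewrite cardsU1 xE cE.
Qed.

(* At most one color can exceed the cap [k], since [#|V| <= 2k]: keep exactly [k] of its
   vertices, including all the forced ones, and recolor the others. *)
Lemma capped_choice (V : finType) (C : choiceType) (A : V -> {fset C}) (k : nat) :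
  (forall v, A v != fset0) -> #|V| <= k.*2 ->
  (exists2 f : V -> C, forall v, f v \in A v &
     forall c, #|[set v | f v == c]%SET| <= k) \/
  (exists c, k < #|[set v | A v == [fset c]]%SET|).
Proof.
move=> A0 cardV.
have /fin_all_exists[f fA]: forall v, exists x, x \in A v by move=> v; apply/fset0Pn.
have [/existsP[v0]|/existsPn fk] := boolP [exists v, k < #|[set w | f w == f v]%SET|];
  last first.
  left; exists f => // c.
  have [->|[v]] := set_0Vmem [set v | f v == c]%SET; first by rewrite cards0.
  by rewrite inE => /eqP <-; rewrite leqNgt fk.
set c := f v0; set D := [set w | _]%SET => ltkD.
set F := [set v | A v == [fset c]]%SET.
have [leFk|] := leqP #|F| k; last by right; exists c.
left.
have sFD : F \subset D.
  by apply/subsetP=> v; rewrite !inE => /eqP Av; have := fA v; rewrite Av inE.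
have [||E [sFE sED cE]] := @exists_intermediate_set V F D k => //; first lia.
have /fin_all_exists[h hP]: forall v, exists x,
    v \notin E -> x \in A v /\ x != c.
  move=> v; have [vE|vE] := boolP (v \in E); first by exists c.
  have [fv|fv] := eqVneq (f v) c; last by exists (f v).
  have: A v `\ c != fset0.
    apply: contraNneq (contraNN (subsetP sFE v) vE) => Av; rewrite inE.
    by rewrite -[A v](fsetD1K (fA v)) fv Av fsetU0.
  by case/fset0Pn => x; rewrite !inE => /andP[xc xA]; exists x.
exists (fun v => if v \in E then c else h v) => [v|d].
  case: ifPn => [vE|/hP[] //].
  by have := subsetP sED v vE; rewrite inE => /eqP <-; apply: fA.
have [->|dc] := eqVneq d c.
  rewrite -cE subset_leq_card //; apply/subsetP=> v; rewrite inE.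
  by case: ifPn => // /hP[_ /negP].
(* Any color other than [c] lives outside [E], on at most 2k - k vertices. *)
apply: (@leq_trans #|~: E|%SET); last by rewrite cardsCs setCK; lia.
apply/subset_leq_card/subsetP=> v; rewrite !inE.
by case: ifPn => // _; rewrite eq_sym (negPf dc).
Qed.

(** * Double counting of forced leaf lists *)

Lemma fset2_inj (C : choiceType) (a b c d : C) :
  [fset a; b] = [fset c; d] -> (a = c /\ b = d) \/ (a = d /\ b = c).
Proof.
move=> E.
have /fset2P ca : a \in [fset c; d] by rewrite -E fset21.
have /fset2P cb : b \in [fset c; d] by rewrite -E fset22.
have /fset2P cc : c \in [fset a; b] by rewrite E fset21.
have /fset2P cd : d \in [fset a; b] by rewrite E fset22.
by case: ca cb cc cd => ->; case=> ->; case=> ?; case=> ?; auto.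
Qed.

Lemma sum_eq_count (I : finType) (C : eqType) (L : I -> C) (ts : seq C) :
  \sum_(t <- ts) \sum_i (L i == t) = \sum_i count_mem (L i) ts.
Proof.
rewrite exchange_big; apply: eq_bigr => i _ /=.
by rewrite -sum1_count [RHS]big_mkcond /=; apply: eq_bigr => t _; rewrite eq_sym; case: eqP.
Qed.

Lemma sum_eq_count_le (m k : nat) (C : eqType) (L : 'I_m -> C) (ts : seq C) :
  (forall t, count_mem t ts <= k) ->
  \sum_(t <- ts) \sum_i (L i == t) <= k * m.
Proof.
move=> cnt; rewrite sum_eq_count mulnC -[X in X * _]card_ord -sum_nat_const.
exact: leq_sum.
Qed.

Section TwoStarsCount.
Variables (m : nat) (C : choiceType).
Hypothesis m7 : m <= 7.
Notation num L p c := (\sum_i (L i == [fset p; c]) : nat).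

Lemma num_uniq_le (L : 'I_m -> {fset C}) (ts : seq {fset C}) :
  uniq ts -> \sum_(t <- ts) \sum_i (L i == t) <= m.
Proof.
move=> uts; rewrite -[leqRHS]mul1n; apply: sum_eq_count_le => t.
by rewrite count_uniq_mem // leq_b1.
Qed.

(** The common list must be {a, b}, which pins down three of the forced colors; the second star then
    needs too many leaves with distinct lists. *)
Lemma forced_triple_absurd (L M : 'I_m -> {fset C}) (a b x y cax cay cbx cby : C) :
  a != b -> x != y ->
  cax != x -> cay != y -> cbx != x -> cby != b -> cby != y ->
  m.+2 <= num L a cax + num M x cax -> m.+2 <= num L a cay + num M y cay ->
  m.+2 <= num L b cbx + num M x cbx -> m.+2 <= num L b cby + num M y cby ->
  [fset a; cax] = [fset a; cay] -> [fset a; cax] = [fset b; cbx] -> False.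
Proof.
move=> /eqP ab /eqP xy /eqP xax /eqP yay /eqP xbx /eqP bby /eqP yby.
have Lle (s : seq {fset C}) := @num_uniq_le L s.
have Mle (s : seq {fset C}) := @num_uniq_le M s.
have L1 t : \sum_i (L i == t) <= m by have := Lle [:: t] isT; rewrite big_seq1.
have M1 t : \sum_i (M i == t) <= m by have := Mle [:: t] isT; rewrite big_seq1.
move=> hax hay hbx hby /fset2_inj e1 /fset2_inj e2.
(* A list occurring for three of the four pairs of center colors contains both [a] and [b]. *)
have ? : cax = b by case: e2 => -[].
have ? : cay = b by case: e1 => -[] *; congruence.
have ? : cbx = a by case: e2 => -[] *; congruence.
subst cax cay cbx.
have nax : [fset b; a] = [fset a; b] by rewrite fsetUC.
rewrite nax in hbx.
have := L1 [fset a; b]; have := L1 [fset b; cby].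
(* If these lists coincide, two lists of [L] and three of [M] remain, and three of the inequalities
   add up to 3m + 6 <= 3m. *)
have [e|/eqP ne] := eqVneq [fset x; a] [fset y; cby].
  have [? ?] : x = cby /\ y = a by case/fset2_inj: e => -[] *; split; congruence.
  subst cby y.
  have /Lle : uniq [:: [fset a; b]; [fset b; x]].
    rewrite /= inE andbT; apply/eqP => /fset2_inj [] []; congruence.
  have /Mle : uniq [:: [fset x; b]; [fset a; b]; [fset x; a]].
    rewrite /= !inE andbT negb_or -!andbA; apply/and3P; split; apply/eqP => /fset2_inj;
      case=> -[]; congruence.
  rewrite -e in hby; rewrite !big_cons !big_nil; lia.
(* Otherwise the four lists of [M] are distinct and share at most m leaves, so the inequalities give
   4(m + 2) <= 3m + m + m, contradicting [m <= 7]. *)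
have /Mle : uniq [:: [fset x; b]; [fset y; b]; [fset x; a]; [fset y; cby]].
  rewrite /= !inE andbT !negb_or -!andbA; do !(apply/andP; split); apply/eqP => //;
    by case/fset2_inj => -[]; congruence.
rewrite !big_cons !big_nil; lia.
Qed.

Definition overloaded (L M : 'I_m -> {fset C}) (p q : C) (c : C) :=
  [/\ c != p, c != q & m.+2 <= num L p c + num M q c].

(** Three equal entries of a two-by-two table include one equal to both its row and its column
    neighbor, which [forced_triple_absurd] excludes. *)
Lemma forced_multiplicity_le2 (L M : 'I_m -> {fset C}) (p q : bool -> C) (c : bool -> bool -> C) :
  p true != p false -> q true != q false ->
  (forall i j, overloaded L M (p i) (q j) (c i j)) ->
  forall t, count_mem t [seq [fset p i; c i j] | i <- [:: true; false], j <- [:: true; false]] <= 2.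
Proof.
move=> pne qne bad t.
have pN i : p i != p (~~ i) by case: i; rewrite // eq_sym.
have qN j : q j != q (~~ j) by case: j; rewrite // eq_sym.
have triple i j : [fset p i; c i j] = [fset p i; c i (~~ j)] ->
    [fset p i; c i j] = [fset p (~~ i); c (~~ i) j] -> False.
  have [? ? ?] := bad i j; have [? ? ?] := bad i (~~ j).
  have [? ? ?] := bad (~~ i) j; have [? ? ?] := bad (~~ i) (~~ j).
  apply: (@forced_triple_absurd L M _ _ (q j) (q (~~ j)) _ _ _ (c (~~ i) (~~ j))) => //.
have := triple true true; have := triple true false.
have := triple false true; have := triple false false.
rewrite /=; case: eqVneq => [->|_]; case: eqVneq => [->|_]; case: eqVneq => [->|_];
  case: eqVneq => [->|_] //= h1 h2 h3 h4; exfalso; auto.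
Qed.

(** Over the four choices each leaf of either star is counted at most twice, so the inequalities
    would add up to 4(m + 2) <= 4m. *)
Lemma not_all_overloaded (L M : 'I_m -> {fset C}) (p q : bool -> C) (c : bool -> bool -> C) :
  p true != p false -> q true != q false ->
  ~ (forall i j, overloaded L M (p i) (q j) (c i j)).
Proof.
move=> pne qne bad.
have bad' i j : overloaded M L (q i) (p j) (c j i).
  by have [? ? ?] := bad j i; split=> //; rewrite addnC.
have := sum_eq_count_le L (forced_multiplicity_le2 pne qne bad).
have := sum_eq_count_le M (forced_multiplicity_le2 qne pne bad').
have [_ _] := bad true true; have [_ _] := bad true false.
have [_ _] := bad false true; have [_ _] := bad false false.
rewrite /= !big_cons !big_nil; lia.
Qed.

End TwoStarsCount.

(** * Balanced colorings of one, two and many stars *)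

Section StarColoring.
Variables (m : nat) (C : choiceType).
Notation star := ('I_1 + 'I_m)%type.
Implicit Types (L : star -> {fset C}) (f : star -> C).

Definition star_coloring L f :=
  (forall v, f v \in L v) /\ forall j, f (inr j) != f (inl ord0).

Definition uses f c := \sum_v (f v == c).

Lemma sum_card_set (T : finType) (P : pred T) : \sum_v P v = #|[set v | P v]%SET|.
Proof.
by rewrite cardsE -sum1_card [RHS]big_mkcond; apply: eq_bigr => v _; rewrite unfold_in; case: (P v).
Qed.

(** A color sits either on the center alone or only on leaves, hence on at most max(1, m)
    vertices. *)
Lemma star_coloring_le2 L f c : m <= 2 -> star_coloring L f -> uses f c <= m.+2./2.
Proof.
move=> m2 [_ pf]; rewrite /uses big_sumType big_ord1 /=.
have [e|_] := eqVneq (f (inl ord0)) c.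
  rewrite big1 => [|j _]; last by rewrite -e (negPf (pf j)).
  by lia.
rewrite add0n; apply: (@leq_trans (\sum_(j < m) 1)); first exact/leq_sum/(fun _ _ => leq_b1 _).
rewrite sum_nat_const card_ord; lia.
Qed.

(* The colors left once the center is colored [p]. *)
Definition residual L p (v : star) : {fset C} :=
  if v is inr _ then L v `\ p else [fset p].

Lemma residual_neq0 L p v : (forall v, #|` L v| = 2) -> residual L p v != fset0.
Proof.
case: v => j L2 /=; first by apply/fset0Pn; exists p; rewrite inE.
by rewrite -cardfs_gt0; have := cardfsD1 p (L (inr j)); rewrite L2; case: (_ \in _) => /= ?; lia.
Qed.

Lemma star_coloring_residual L p f :
  p \in L (inl ord0) -> (forall v, f v \in residual L p v) -> star_coloring L f.
Proof.
move=> pL fr; have f0 : f (inl ord0) = p by have := fr (inl ord0); rewrite inE => /eqP.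
split=> [[i|j]|j].
- by rewrite (ord1 i) f0.
- by have := fr (inr j); rewrite !inE => /andP[].
by have := fr (inr j); rewrite !inE f0 => /andP[].
Qed.

(** Leaves lose [p], so [p] can be forced only at the center; a leaf left with [c] alone had two
    colors, hence the list {p, c}. *)
Lemma residual_forced L p c : (forall v, #|` L v| = 2) ->
  \sum_v (residual L p v == [fset c]) <=
  (if c == p then 1 else \sum_j (L (inr j) == [fset p; c])).
Proof.
move=> L2; rewrite big_sumType big_ord1 /=.
have Lp j : L (inr j) `\ p = [fset c] -> (c != p) && (L (inr j) == [fset p; c]).
  move=> e; have : c \in L (inr j) `\ p by rewrite e inE.
  rewrite !inE => /andP[-> _] /=; rewrite -e fsetD1K //.
  have := cardfsD1 p (L (inr j)); rewrite L2 e cardfs1; by case: (p \in _).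
have [ecp|ncp] := eqVneq c p.
  rewrite ecp eqxx big1 // => j _; case: eqP => // e; have := Lp j.
  by rewrite ecp e eqxx => /(_ erefl).
have -> : ([fset p] == [fset c]) = false.
  by apply/eqP => e; move: ncp; rewrite -(in_fset1 p) e inE eqxx.
rewrite add0n leq_sum // => j _; case: eqP => // /Lp /andP[_ ->] //.
Qed.

Lemma two_star_coloring (L M : star -> {fset C}) : 0 < m <= 7 ->
  (forall v, #|` L v| = 2) -> (forall v, #|` M v| = 2) ->
  exists f g, [/\ star_coloring L f, star_coloring M g &
    forall c, uses f c + uses g c <= m.+1].
Proof.
move=> /andP[m0 m7] L2 M2.
have list2 (A : {fset C}) : #|` A| = 2 -> exists p : bool -> C, 
    p true != p false /\ forall i, p i \in A.
  move=> cA; have /fset0Pn[x xA] : A != fset0 by rewrite -cardfs_gt0 cA.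
  have /fset0Pn[y] : A `\ x != fset0.
    by rewrite -cardfs_gt0; have := cardfsD1 x A; rewrite cA xA /=; lia.
  rewrite !inE eq_sym => /andP[xy yA]; exists (fun i => if i then x else y).
  by split=> // -[].
have [p [pne pL]] := list2 _ (L2 (inl ord0)).
have [q [qne qM]] := list2 _ (M2 (inl ord0)).
pose good f g := [/\ star_coloring L f, star_coloring M g &
    forall c, uses f c + uses g c <= m.+1].
have dich i j : (exists f g, good f g) \/
    exists c, overloaded (L \o inr) (M \o inr) (p i) (q j) c.
  (* The two stars together have 2m + 2 vertices, twice the cap [m.+1]. *)
  pose A (v : star + star) :=
    match v with inl u => residual L (p i) u | inr u => residual M (q j) u end.
  have [|| [h hA hc] | [c]] := @capped_choice _ _ A m.+1.
  - by case=> u; apply: residual_neq0.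
  - by rewrite !card_sum !card_ord; lia.
  - left; exists (h \o inl), (h \o inr); split.
    + by apply: star_coloring_residual (pL i) _ => v; apply: (hA (inl v)).
    + by apply: star_coloring_residual (qM j) _ => v; apply: (hA (inr v)).
    by move=> c; have := hc c; rewrite -sum_card_set big_sumType.
  rewrite -sum_card_set big_sumType /= => big; right; exists c.
  have := residual_forced (p i) c L2; have := residual_forced (q j) c M2.
  have num_le (N : 'I_m -> {fset C}) t : \sum_k (N k == t) <= m.
    rewrite -[leqRHS]card_ord -sum1_card; apply: leq_sum => k _; exact: leq_b1.
  have := num_le (L \o inr) [fset p i; c]; have := num_le (M \o inr) [fset q j; c].
  rewrite /= => ? ?.
  (* A center color is forced on at most m + 1 vertices (if both centers share it, on 2, and
     [0 < m]), so [c] differs from both. *)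
  case: eqVneq => ?; case: eqVneq => ? ? ?; [lia | lia | lia |].
  by split=> //=; lia.
have [[f [g fg]]|c1] := dich true true; first by exists f, g.
have [[f [g fg]]|c2] := dich true false; first by exists f, g.
have [[f [g fg]]|c3] := dich false true; first by exists f, g.
have [[f [g fg]]|c4] := dich false false; first by exists f, g.
case: c1 c2 c3 c4 => [c1 b1] [c2 b2] [c3 b3] [c4 b4]; exfalso.
apply: (@not_all_overloaded _ _ m7 (L \o inr) (M \o inr) p q
  (fun i j => if i then if j then c1 else c2 else if j then c3 else c4)) => //.
by case=> -[].
Qed.

Lemma stars_coloring (k : nat) (L : nat -> star -> {fset C}) : 0 < m <= 7 ->
  (forall i v, #|` L i v| = 2) ->
  exists f : nat -> star -> C, (forall i, i < k.*2 -> star_coloring (L i) (f i)) /\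
    forall c, \sum_(i < k.*2) uses (f i) c <= k * m.+1.
Proof.
move=> m17 L2; elim: k => [|k [f [fL fc]]].
  (* [C] is not assumed inhabited; an actual coloring supplies the values. *)
  have [f _] : exists f, star_coloring (L 0) f.
    by have [f [_ [fL _ _]]] := two_star_coloring m17 (L2 0) (L2 0); exists f.
  by exists (fun=> f); split=> // c; rewrite big_ord0.
have [g [h [gL hL ghc]]] := two_star_coloring m17 (L2 k.*2) (L2 k.*2.+1).
exists (fun i => if i < k.*2 then f i else if i == k.*2 then g else h); split=> [i|c].
  rewrite doubleS => ltik; case: ifP => [/fL //|/negbT leki].
  case: eqP => [->//|/eqP ne]; have -> : i = k.*2.+1 by lia.
  exact: hL.
rewrite doubleS !big_ord_recr /= ltnn eqxx ltnNge leqnSn /= (gtn_eqF (ltnSn _)).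
rewrite (eq_bigr (fun i : 'I_(k.*2) => uses (f i) c)) => [|i _]; last by rewrite ltn_ord.
by rewrite mulSn -addnA addnC leq_add ?ghc ?fc.
Qed.

Lemma stars_coloring_half (n : nat) (L : nat -> star -> {fset C}) : 0 < m <= 7 ->
  (odd n -> m <= 2) -> (forall i v, #|` L i v| = 2) ->
  exists f : nat -> star -> C, (forall i, i < n -> star_coloring (L i) (f i)) /\
    forall c, \sum_(i < n) uses (f i) c <= ((n * m.+1).+1)./2.
Proof.
move=> m17 m2 L2; have [f [fL fc]] := stars_coloring n./2 m17 L2.
move: m2; rewrite -(odd_double_half n) oddD odd_double addbF oddb.
case: (odd n) => m2.
  have [g [_ [gL _ _]]] := two_star_coloring m17 (L2 n./2.*2) (L2 n./2.*2).
  exists (fun i => if i < n./2.*2 then f i else g); split=> [i|c].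
    rewrite add1n ltnS leq_eqVlt; case: ltnP => [/fL //|_]; rewrite orbF => /eqP -> //.
  rewrite add1n big_ord_recr [X in _ + X <= _]/= ltnn.
  rewrite (eq_bigr (fun i : 'I_(n./2.*2) => uses (f i) c)) => [|i _]; last by rewrite /= ltn_ord.
  apply: leq_trans (leq_add (fc c) (star_coloring_le2 c (m2 isT) gL)) _.
  (* For n = 2k + 1, the cap is k(m + 1) plus the allowance [m.+2./2] of the leftover star. *)
  have -> : ((n./2.*2.+1 * m.+1).+1 = (n./2 * m.+1).*2 + m.+2)%N by lia.
  by rewrite halfD odd_double doubleK.
exists f; split=> // c; apply: leq_trans (fc c) _.
by rewrite add0n -doubleMl; lia.
Qed.

End StarColoring.

(** * Unbalanced list assignments *)

Section TwoColors.
Variable m : nat.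
Notation star := ('I_1 + 'I_m)%type.

Lemma two_color_star (L : star -> {fset nat}) (f : star -> nat) :
  (forall v, L v = [fset 0; 1]) -> star_coloring L f ->
  (uses f 0 = 1 /\ uses f 1 = m) \/ (uses f 0 = m /\ uses f 1 = 1).
Proof.
move=> LE [fL fp]; rewrite /uses !big_sumType !big_ord1 /=.
have f01 v : f v = 0 \/ f v = 1.
  by have := fL v; rewrite LE !inE => /orP[] /eqP; auto.
have const c d : c != d -> (forall j : 'I_m, f (inr j) = c) ->
  \sum_j (f (inr j) == c) = m /\ \sum_j (f (inr j) == d) = 0.
  move=> cd fc; split; last by rewrite big1 // => j _; rewrite fc (negPf cd).
  by rewrite (eq_bigr (fun=> 1)) ?sum1_card ?card_ord // => j _; rewrite fc eqxx.
have [f0|f0] := f01 (inl ord0); rewrite f0 /=; [left|right].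
  have [//||-> ->] := @const 1 0; last by rewrite addn0.
  by move=> j; have := fp j; rewrite f0; case: (f01 (inr j)) => ->.
have [//||-> ->] := @const 0 1; last by rewrite addn0.
by move=> j; have := fp j; rewrite f0; case: (f01 (inr j)) => ->.
Qed.

(** Here [a] and [b] count the stars whose center is colored 0 and 1. *)
Lemma two_color_stars (n : nat) (L : nat -> star -> {fset nat}) (f : nat -> star -> nat) :
  (forall i v, i < n -> L i v = [fset 0; 1]) ->
  (forall i, i < n -> star_coloring (L i) (f i)) ->
  exists a b, [/\ a + b = n, \sum_(i < n) uses (f i) 0 = a + b * m &
    \sum_(i < n) uses (f i) 1 = a * m + b]%N.
Proof.
elim: n => [|n IHn] LE fL; first by exists 0, 0; rewrite !big_ord0.
have [||a [b [ab e0 e1]]] := IHn; try by move=> *; auto.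
rewrite !big_ord_recr /= e0 e1.
have [|[-> ->]|[-> ->]] := @two_color_star (L n) (f n) _ (fL n (ltnSn n)).
- by move=> v; apply: LE.
- by exists a.+1, b; split; lia.
by exists a, b.+1; split; lia.
Qed.

(** 2(a + bm) - (a + b)(m + 1) = (b - a)(m - 1), which is at least m - 1. *)
Lemma stars_excess (a b : nat) :
  (a < b -> 0 < m -> (a + b) * m.+1 + m <= (a + b * m).*2 + 1)%N.
Proof. by move=> /subnKC <- /prednK <-; nia. Qed.

(** Leaves beyond the eighth get {0, 2}, the default of [nth]. *)
Definition cross_list (v : star) : {fset nat} :=
  if v is inr j then nth [fset 0; 2] [:: [fset 0; 2]; [fset 0; 2]; [fset 0; 3]; [fset 0; 3];
    [fset 1; 2]; [fset 1; 2]; [fset 1; 3]; [fset 1; 3]] j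
  else [fset 2; 3].

Lemma card_cross_list v : #|` cross_list v| = 2.
Proof.
case: v => [i|[j _]] /=; first by rewrite cardfs2.
by do 8![case: j => [|j] /=; first by rewrite cardfs2]; rewrite nth_nil cardfs2.
Qed.

Lemma cross_list_uses (f : star -> nat) : 8 <= m -> star_coloring cross_list f ->
  1 < uses f 0 /\ 1 < uses f 1.
Proof.
move=> m8 [fL fp].
have two c (j k : nat) (jm : j < m) (km : k < m) : j != k ->
    f (inr (Ordinal jm)) = c -> f (inr (Ordinal km)) = c -> 1 < uses f c.
  move=> jk fj fk; rewrite /uses (bigD1 (inr (Ordinal jm))) //=.
  by rewrite (bigD1 (inr (Ordinal km))) /= ?fj ?fk ?eqxx //; apply: contraNneq jk => -[->].
have force c d j (jm : j < m) : cross_list (inr (Ordinal jm)) = [fset c; d] ->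
    f (inl ord0) = d -> f (inr (Ordinal jm)) = c.
  move=> E fd; have := fp (Ordinal jm); have := fL (inr (Ordinal jm)).
  by rewrite E fd !inE => /orP[/eqP //|->].
have lt8m k : k < 8 -> k < m by move=> k8; apply: leq_trans m8.
(* Center 2 forces 0 on leaves 0, 1 and 1 on leaves 4, 5; center 3 forces 0 on leaves 2, 3 and 1 on
   leaves 6, 7. *)
have := fL (inl ord0); rewrite !inE => /orP[] /eqP f0; split.
- by apply: (@two 0 0 1 (lt8m 0 isT) (lt8m 1 isT)) => //; apply: (force _ _ _ _ _ f0).
- by apply: (@two 1 4 5 (lt8m 4 isT) (lt8m 5 isT)) => //; apply: (force _ _ _ _ _ f0).
- by apply: (@two 0 2 3 (lt8m 2 isT) (lt8m 3 isT)) => //; apply: (force _ _ _ _ _ f0).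
- by apply: (@two 1 6 7 (lt8m 6 isT) (lt8m 7 isT)) => //; apply: (force _ _ _ _ _ f0).
Qed.
End TwoColors.

(** * From single stars to their disjoint union *)

Section StarCopies.
Variables (m n : nat) (C : choiceType).
Notation star := ('I_1 + 'I_m)%type.
Notation G := (disjoint_copies n.+1 (complete_bipartite 1 m)).

Lemma card_star_copies : #|G| = (n.+1 * m.+1)%N.
Proof. by rewrite card_prod card_sum !card_ord. Qed.

(** Edges stay inside a copy and color counts add up over the copies. *)
Lemma equitable_star_copiesP (L : G -> {fset C}) (f : G -> C) :
  equitable_list_coloring 2 L f <->
  (forall i : 'I_n.+1, star_coloring (fun v => L (i, v)) (fun v => f (i, v))) /\
  forall c, c \in palette L ->
    \sum_(i < n.+1) uses (fun v => f (i, v)) c <= ((n.+1 * m.+1).+1)./2.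
Proof.
have sumE c : \sum_(i < n.+1) uses (fun v => f (i, v)) c = #|[set v | f v == c]%SET|.
  by rewrite -sum_card_set pair_big; apply: eq_bigr => -[].
have ceilE : ceil_divn #|G| 2 = ((n.+1 * m.+1).+1)./2.
  by rewrite /ceil_divn card_star_copies addn1 divn2.
split=> [[[proper fL] cap]|[fL cap]].
  split=> [i|c cL]; last by rewrite sumE -ceilE; apply: cap.
  by split=> [v|j]; [apply: fL | apply/eqP/proper; rewrite /= /copies_adj /= eqxx].
split=> [|c cL]; last by rewrite ceilE -sumE; apply: cap.
split=> [[i u] [j v] /= /andP[/= /eqP <-]|[i v]]; last by have [] := fL i.
have [_ fp] := fL i.
by case: u v => [u|u] [v|v] //= _; rewrite ?(ord1 u) ?(ord1 v); apply/eqP; rewrite // eq_sym.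
Qed.
End StarCopies.

Lemma star_copies_choosable (m n : nat) : 0 < m <= 7 -> (odd n.+1 -> m <= 2) ->
  equitably_choosable 2 (disjoint_copies n.+1 (complete_bipartite 1 m)).
Proof.
move=> m17 m2 C L L2.
have [f [fL fc]] := stars_coloring_half (L := fun i v => L (inord i, v)) m17 m2
  (fun i v => L2 (inord i, v)).
exists (fun u : 'I_n.+1 * _ => f u.1 u.2); apply/equitable_star_copiesP.
split=> [i|c _]; last exact: fc.
by have := fL i (ltn_ord i); rewrite inord_val.
Qed.

Lemma odd_star_copies_not_choosable (m n : nat) : odd n.+1 -> 2 < m ->
  ~ equitably_choosable 2 (disjoint_copies n.+1 (complete_bipartite 1 m)).
Proof.
move=> oddn m3 ch.
have [|f /equitable_star_copiesP[fL cap]] := ch nat (fun=> [fset 0; 1]).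
  by move=> v; rewrite cardfs2.
have pal c : c \in [fset 0; 1] ->
    c \in palette (fun _ : disjoint_copies n.+1 (complete_bipartite 1 m) => [fset 0; 1]).
  by move=> cL; apply/bigfcupP; exists (ord0, inl ord0); rewrite ?mem_index_enum.
have [||a [b [ab e0 e1]]] := @two_color_stars m n.+1 (fun _ _ => [fset 0; 1])
  (fun i v => f (inord i, v)) => //.
have := cap 0 (pal 0 (fset21 _ _)); have := cap 1 (pal 1 (fset22 _ _)).
have E c : \sum_(i < n.+1) uses (fun v => f (i, v)) c =
    \sum_(i < n.+1) uses (fun v => f (inord i, v)) c.
  by apply: eq_bigr => i _; rewrite inord_val.
rewrite !E e0 e1 => c1 c0.
(* As a + b is odd, a and b differ. Twice the uses of one color exceed the vertex count by at least
   m - 1 >= 2; the cap allows 1. *)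
have [ltab|ltba|eqab] := ltngtP a b; last by move: oddn; rewrite -ab eqab addnn odd_double.
  have := stars_excess ltab (ltnW (ltnW m3)).
  by move: c0; rewrite -ab; lia.
have := stars_excess ltba (ltnW (ltnW m3)).
by move: c1; rewrite -ab; lia.
Qed.

Lemma even_star_copies_not_choosable (m n : nat) : 0 < n -> ~~ odd n.+1 -> 7 < m ->
  ~ equitably_choosable 2 (disjoint_copies n.+1 (complete_bipartite 1 m)).
Proof.
move=> n0 evenn m8 ch.
pose L (u : disjoint_copies n.+1 (complete_bipartite 1 m)) : {fset nat} :=
  if u.1 < n then [fset 0; 1] else cross_list u.2.
have [|f /equitable_star_copiesP[fL cap]] := ch nat L.
  by move=> v; rewrite /L; case: ifP => _; rewrite ?cardfs2 ?card_cross_list.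
(* Star 0 has lists {0, 1} since [0 < n]. *)
have pal c : c \in [fset 0; 1] -> c \in palette L.
  by move=> cL; apply/bigfcupP; exists (ord0, inl ord0); rewrite ?mem_index_enum // /L n0.
have [||a [b [ab e0 e1]]] := @two_color_stars m n (fun i v => L (inord i, v))
  (fun i v => f (inord i, v)) => //.
  by move=> i v ltin; rewrite /L /= inordK ?ltin // ltnW.
have [|u0 u1] := @cross_list_uses m (fun v => f (ord_max, v)) m8.
  by have := fL ord_max; rewrite /L /= ltnn.
have := cap 0 (pal 0 (fset21 _ _)); have := cap 1 (pal 1 (fset22 _ _)).
have E c : \sum_(i < n) uses (fun v => f (widen_ord (leqnSn n) i, v)) c =
    \sum_(i < n) uses (fun v => f (inord i, v)) c.
  apply: eq_bigr => i _; suff -> : widen_ord (leqnSn n) i = inord i by [].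
  by apply: val_inj; rewrite /= inordK // ltnW // ltnS.
rewrite !big_ord_recr /= !E e0 e1 => c1 c0.
(* Twice the uses of one color on the first n stars is at least n(m + 1) + m - 1; two more uses on
   the last star bring it to (n + 1)(m + 1) + 2, above twice the cap. *)
have [ltab|ltba|eqab] := ltngtP a b; last by move: evenn; rewrite -ab eqab addnn /= odd_double.
  have := stars_excess ltab (ltn_trans (isT : 0 < 7) m8).
  by move: (leq_trans (leq_add (leqnn _) u0) c0); rewrite -ab; nia.
have := stars_excess ltba (ltn_trans (isT : 0 < 7) m8).
by move: (leq_trans (leq_add (leqnn _) u1) c1); rewrite -ab; nia.
Qed.

Theorem theorem1p5 (n m : nat) (hn : 2 <= n) (hm : 1 <= m) :
  (odd n ->
     (equitably_choosable 2 (disjoint_copies n (complete_bipartite 1 m)) <-> m <= 2)) /\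
  (~~ odd n ->
     (equitably_choosable 2 (disjoint_copies n (complete_bipartite 1 m)) <-> m <= 7)).
Proof.
case: n hn => // n hn; split=> oddn; split=> [ch|m_le].
- by rewrite leqNgt; apply/negP => m3; apply: odd_star_copies_not_choosable ch.
- by apply: star_copies_choosable => //; rewrite hm (leq_trans m_le).
- by rewrite leqNgt; apply/negP => m8; apply: even_star_copies_not_choosable ch.
by apply: star_copies_choosable; rewrite ?hm // (negPf oddn).
Qed.
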